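(* Let $n,k\ge 0$ be integers with $n\ge 2k$, and for $0\le s\le k$ let $\Pi_{n,s}=\{w\in S_n : w_1<w_2<\cdots<w_{n-s},\ \operatorname{is}(w)=n-s\}$. Then $$\sum_{s=0}^{k}\binom{k}{s}\,\#\Pi_{n,s}=\binom{n}{k}k!.$$
   Context: Permutations $w\in S_n$ are written in one-line notation $w=w_1w_2\cdots w_n$. $\operatorname{is}(w)$ denotes the maximal length of an increasing subsequence of $w$. *)

(* Defs.v *)
From mathcomp Require Import all_boot all_fingroup.

Set Implicit Arguments.
Unset Strict Implicit.
Unset Printing Implicit Defensive.

(* Positions and values are numbered from 0: [w i] is the letter w_{i+1} of
   the one-line notation, decreased by 1. A subsequence of w is given by its
   set A of positions. *)
Definition increasing_on (n : nat) (w : 'S_n) (A : {set 'I_n}) : bool :=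
  [forall i in A, forall j in A, (i < j) ==> (w i < w j)].

Definition lis (n : nat) (w : 'S_n) : nat :=
  \max_(A : {set 'I_n} | increasing_on w A) #|A|.

(* [n - s] is truncated; it is the ordinary difference when s <= n. *)
Definition Pi (n s : nat) : {set 'S_n} :=
  [set w : 'S_n | increasing_on w [set i : 'I_n | i < n - s]
                  && (lis w == n - s)].

(* Main.v *)
Require Import Defs.
From mathcomp Require Import all_boot all_fingroup.
From mathcomp Require Import all_order zify.

(* Insert the last k letters of a permutation with w_1 < ... < w_{n-k} into the
   row w_1 ... w_{n-k} by Schensted's row insertion: a letter either bumps an
   entry of the row or is appended to it. By Schensted's theorem is(w) is the
   final length of the row, so the elements of Pi_{n,s} are those for which all
   of the last s letters bump. Insertion is invertible given the final row, the
   bumped letters and the set of bumping times. Which lists of s bumped letters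
   occur depends only on the s smallest entries of the final row, so when
   2k <= n it does not depend on the set of times. Hence each of the C(k, s)
   sets of s times is realised by #Pi_{n,s} permutations. *)

Set Implicit Arguments.
Unset Strict Implicit.
Unset Printing Implicit Defensive.

Import Order.POrderTheory Order.TotalTheory.

(** * Inserting one letter into a sorted row, and undoing it *)

Section RowInsertion.
Variables (d : Order.disp_t) (T : orderType d).
Implicit Types (x y : T) (R a st t word : seq T) (m : bitseq) (P : pred T).
Local Open Scope order_scope.

Lemma uniq_cat_cons R x a :
  uniq (R ++ x :: a) = (x \notin R ++ a) && uniq (R ++ a).
Proof. by rewrite -cat1s uniq_catCA. Qed.

Fixpoint row_insert R x : seq T * option T :=
  if R is r :: R' then
    if x < r then (x :: R', Some r)
    else let: (R1, o) := row_insert R' x in (r :: R1, o)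
  else ([:: x], None).

(** Reverse row insertion: in a sorted row, [y] takes the place of the largest entry below it, and
    that entry is released as the letter whose insertion bumped [y]. Failure means that no entry
    lies below [y]. *)
Fixpoint row_extract R y : option (seq T * T) :=
  if R is r :: R' then
    if r < y then
      if row_extract R' y is Some (R1, x) then Some (r :: R1, x)
      else Some (y :: R', r)
    else None
  else None.

Variant row_insert_spec x : seq T -> seq T * option T -> Prop :=
| RowAppend R of all (< x) R : row_insert_spec x R (rcons R x, None)
| RowBump R1 y R2 of all (< x) R1 & x < y :
    row_insert_spec x (R1 ++ y :: R2) (R1 ++ x :: R2, Some y).

Lemma row_insertP R x : x \notin R -> row_insert_spec x R (row_insert R x).
Proof.
elim: R => [|r R IH] /=; first by move=> _; exact: (@RowAppend x [::]).
rewrite inE negb_or => /andP[xr xR].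
case: ltP => [ltxr|]; first exact: (@RowBump x [::]).
rewrite le_eqVlt eq_sym (negPf xr) /= => ltrx.
case: (IH xR) => [R1 R1x|R1 y R2 R1x xy].
  by rewrite -rcons_cons; apply: RowAppend; rewrite /= ltrx.
by rewrite -!cat_cons; apply: RowBump; rewrite //= ltrx.
Qed.

Lemma row_insert_cat R1 R2 x : all (< x) R1 ->
  row_insert (R1 ++ R2) x = let: (R', o) := row_insert R2 x in (R1 ++ R', o).
Proof.
elim: R1 => [|r R1 IH] /=; first by case: row_insert.
by case/andP=> ltrx R1x; rewrite lt_gtF // IH //; case: row_insert.
Qed.

Lemma row_insert_append R x : all (< x) R -> row_insert R x = (rcons R x, None).
Proof. by move=> Rx; rewrite -[R in LHS]cats0 row_insert_cat //= cats1. Qed.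

Lemma row_extract_None R y : all (> y) R -> row_extract R y = None.
Proof. by case: R => //= r R /andP[ltyr _]; rewrite lt_gtF. Qed.

Lemma row_extract_cat R1 x R2 y : sorted <%O (R1 ++ x :: R2) -> x < y ->
  all (> y) R2 -> row_extract (R1 ++ x :: R2) y = Some (R1 ++ y :: R2, x).
Proof.
move=> + ltxy R2y; elim: R1 => [|r R1 IH] /=.
  by rewrite ltxy row_extract_None.
rewrite path_sortedE; last exact: lt_trans.
rewrite all_cat /= => /andP[/and3P[_ ltrx _] sR].
by rewrite (lt_trans ltrx ltxy) IH.
Qed.

Lemma row_extract_SomeE R y R' x : sorted <%O R -> y \notin R ->
    row_extract R y = Some (R', x) ->
  exists R1 R2, [/\ R = R1 ++ x :: R2, R' = R1 ++ y :: R2, x < y & all (> y) R2].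
Proof.
elim: R R' x => //= r R IH R' x rR.
rewrite inE negb_or => /andP[yr yR].
case: ltP => // ltry.
case E: row_extract => [[R1 z]|] [<- <-].
  have [R2 [R3 [-> -> ltzy yR3]]] := IH _ _ (path_sorted rR) yR E.
  by exists (r :: R2), R3.
(* Extraction failed on the tail, so the head of the tail is not below [y]; as [y] is not in the
   row, sortedness puts the whole tail above [y]. *)
exists [::], R; split=> //; case: R {IH} rR yR E => //= s R /andP[_ sR].
rewrite inE negb_or => /andP[ys _].
case: ltP => [|+ _]; first by case: row_extract => [[]|].
rewrite le_eqVlt (negPf ys) /= => ltys; rewrite ltys /=.
move: sR; rewrite path_sortedE; last exact: lt_trans.
by case/andP=> /allP sR _; apply/allP=> z /sR; apply: lt_trans.
Qed.

Lemma lt_sorted_cat R1 R2 : sorted <%O (R1 ++ R2) =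
  [&& allrel <%O R1 R2, sorted <%O R1 & sorted <%O R2].
Proof. by rewrite !(sorted_pairwise lt_trans) pairwise_cat. Qed.

Lemma lt_sorted_rcons R x :
  sorted <%O (rcons R x) = all (< x) R && sorted <%O R.
Proof. by rewrite -cats1 lt_sorted_cat allrel1r andbT. Qed.

Lemma lt_sorted_catcons R1 x R2 : sorted <%O (R1 ++ x :: R2) =
  [&& all (< x) R1, all (> x) R2 & sorted <%O (R1 ++ R2)].
Proof.
rewrite !(sorted_pairwise lt_trans) !pairwise_cat /= allrel_consr.
by case: (all (< x) R1); case: (all (> x) R2); rewrite /= ?andbF.
Qed.

Variant row_step x R : seq T * option T -> Prop :=
| StepAppend of all (< x) R & sorted <%O (rcons R x) :
    row_step x R (rcons R x, None)
| StepBump R1 y R2 of all (< x) R1 & x < y & all (> y) R2 & R = R1 ++ y :: R2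
    & sorted <%O (R1 ++ x :: R2)
    & row_extract (R1 ++ x :: R2) y = Some (R, x) :
    row_step x R (R1 ++ x :: R2, Some y).

Lemma row_stepP R x :
  sorted <%O R -> x \notin R -> row_step x R (row_insert R x).
Proof.
move=> sR xR; case: (row_insertP xR) sR => [R1 R1x sR|R1 y R2 R1x xy sR].
  by constructor=> //; rewrite lt_sorted_rcons R1x.
have:= sR; rewrite lt_sorted_catcons => /and3P[R1y R2y sR12].
have sR' : sorted <%O (R1 ++ x :: R2).
  rewrite lt_sorted_catcons R1x sR12 andbT /=.
  by apply/allP=> z /(allP R2y); apply: lt_trans.
by constructor=> //; rewrite row_extract_cat.
Qed.

Lemma row_extract_insert R y R' x : sorted <%O R -> y \notin R ->
    row_extract R y = Some (R', x) ->
  [/\ row_insert R' x = (R, Some y), sorted <%O R'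
    & perm_eq (x :: R') (y :: R)].
Proof.
move=> sR yR /(row_extract_SomeE sR yR) [R1 [R2 [eR -> xy R2y]]].
move: sR; rewrite eR lt_sorted_catcons => /and3P[R1x R2x sR12]; split.
- by rewrite row_insert_cat //= xy.
- rewrite lt_sorted_catcons R2y sR12 andbT /= andbT.
  by apply/allP=> z /(allP R1x) zx; apply: lt_trans xy.
- by apply/seq.permP=> p /=; rewrite !count_cat /=; lia.
Qed.

(** * Inserting a whole word: reversibility given the bumping mask *)

(* [a] lists the inserted letters from last to first, and so does the list of
   bumped letters; the mask records which insertions bumped a letter. *)
Fixpoint run R0 a : seq T * seq T * bitseq :=
  if a is x :: a' then
    let: (R, st, m) := run R0 a' in
    if row_insert R x is (R', Some y) then (R', y :: st, true :: m)
    else (rcons R x, st, false :: m)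
  else (R0, [::], [::]).

Fixpoint extractable R st : bool :=
  if st is y :: st' then
    if row_extract R y is Some (R', _) then extractable R' st' else false
  else true.

(** If the truncated and the full row replace different entries, then more than [k.+1] leading
    entries lie below [y]. Both replacements then fall beyond position [k], where [take k] hides
    them. *)
Lemma row_extract_take k R y :
  omap (fun p => take k p.1) (row_extract (take k.+1 R) y)
  = omap (fun p => take k p.1) (row_extract R y).
Proof.
elim: R k => // r R IH [|k] /=; case: ifP => // _.
  by rewrite take0 /=; case: row_extract => [[R1 x]|] /=; rewrite ?take0.
move: (IH k); case: row_extract => [[R1 x]|]; case: row_extract => [[R2 z]|] //=.
  by case=> ->.
by move=> _; rewrite take_takel // leqnSn.
Qed.

(* Only the smallest [size st] entries of the row matter, hence appending or
   deleting large entries does not affect extractability. *)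
Lemma extractable_take R st :
  extractable (take (size st) R) st = extractable R st.
Proof.
elim: st R => // y st IH R.
have E R1 : extractable R1 (y :: st) =
    if omap (fun p => take (size st) p.1) (row_extract R1 y) is Some R2
    then extractable R2 st else false.
  by rewrite /=; case: row_extract => [[R2 z]|] //=; rewrite IH.
by rewrite [LHS]E [RHS]E row_extract_take.
Qed.

Lemma extractable_rcons R x st : (size st <= size R)%N ->
  extractable (rcons R x) st = extractable R st.
Proof.
move=> le_st; rewrite -extractable_take -cats1 takel_cat //.
exact: extractable_take.
Qed.

(** A bump exchanges the new letter for the bumped one and keeps the length of the row; an append
    lengthens the row by one. No letter is lost. *)
Lemma runP R0 a : sorted <%O R0 -> uniq (R0 ++ a) ->
  forall R st m, run R0 a = (R, st, m) ->
  [/\ sorted <%O R, perm_eq (R ++ st) (R0 ++ a), size m = size a,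
      count id m = size st & size R = (size R0 + count negb m)%N].
Proof.
move=> sR0; elim: a => [|x a IH] /=.
  by move=> _ R st m [<- <- <-]; rewrite addn0.
rewrite uniq_cat_cons /= => /andP[xRa /IH] + R st m.
case: run => [[R1 st1] m1] /(_ _ _ _ erefl)[sR1 pR1 szm szst szR1].
have xR1 : x \notin R1.
  by apply: contra xRa => xR; rewrite -(perm_mem pR1) mem_cat xR.
case: (row_stepP sR1 xR1) => [R1x sR1x|R2 y R3 _ _ _ eR1 sR' _] [<- <- <-].
  split=> //=; rewrite ?szm ?size_rcons ?szR1 ?add1n ?addnS //.
  apply/seq.permP=> p; have /seq.permP/(_ p) := pR1.
  by rewrite -cats1 !count_cat /= => ?; lia.
split=> //=; rewrite ?szm ?add1n ?szst //; last by rewrite -szR1 eR1 !size_cat.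
apply/seq.permP=> p; have /seq.permP/(_ p) := pR1.
by rewrite eR1 !count_cat /= => ?; lia.
Qed.

(** A bump is undone directly by [row_extract]. An appended letter lies beyond the part of the row
    that matters, since there are at most [size a] bumped letters and the row is at least as long as
    [R0]. *)
Lemma run_extractable R0 a : sorted <%O R0 -> uniq (R0 ++ a) ->
  (size a <= size R0)%N ->
  forall R st m, run R0 a = (R, st, m) -> extractable R st.
Proof.
move=> sR0; elim: a => [|x a IH] /=; first by move=> _ _ R st m [_ <- _].
rewrite uniq_cat_cons /= => /andP[xRa uRa] lt_a R st m.
move: (IH uRa (ltnW lt_a)) (runP sR0 uRa).
case: run => [[R1 st1] m1] /(_ _ _ _ erefl) ex1.
move=> /(_ _ _ _ erefl)[sR1 pR1 szm szst szR1].
have xR1 : x \notin R1.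
  by apply: contra xRa => xR; rewrite -(perm_mem pR1) mem_cat xR.
case: (row_stepP sR1 xR1) => [R1x sR1x|R2 y R3 _ _ _ eR1 sR' E] [<- <- _].
  rewrite extractable_rcons // -szst szR1.
  by have := count_size id m1; lia.
by rewrite /= E.
Qed.

(** The steps are undone from the last one: the outcome shows whether it was an append, undone by
    deleting the end of the row, or a bump, undone by [row_extract]. *)
Lemma run_inj R0 a R0' a' : sorted <%O R0 -> uniq (R0 ++ a) ->
    sorted <%O R0' -> uniq (R0' ++ a') ->
  run R0 a = run R0' a' -> R0 = R0' /\ a = a'.
Proof.
move=> sR0 + sR0'; elim: a a' => [|x a IH] [|x' a'].
- by move=> _ _ [].
- by move=> _ _ /=; case: run => [[R st] m]; case: row_insert => [R1 [y|]].
- by move=> _ _ /=; case: run => [[R st] m]; case: row_insert => [R1 [y|]].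
rewrite !uniq_cat_cons /=.
move=> /andP[xRa uRa] /andP[xRa' uRa'].
move: (IH _ uRa uRa') (runP sR0 uRa) (runP sR0' uRa').
case: run => [[R st] m]; case: run => [[R' st'] m'] IHa.
move=> /(_ _ _ _ erefl)[sR pR _ _ _] /(_ _ _ _ erefl)[sR' pR' _ _ _].
have xR : x \notin R.
  by apply: contra xRa => xR; rewrite -(perm_mem pR) mem_cat xR.
have xR' : x' \notin R'.
  by apply: contra xRa' => xR'; rewrite -(perm_mem pR') mem_cat xR'.
case: (row_stepP sR xR) => [_ _|R1 y R2 _ _ _ _ _ E];
  case: (row_stepP sR' xR') => [_ _|R1' y' R2' _ _ _ _ _ E'] //.
  case=> e est em; have [eR ->] := rcons_inj e.
  by case: IHa => [|-> ->]; rewrite ?eR ?est ?em.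
case=> eR ey est em; move: E; rewrite eR ey E' => -[eR1 ->].
by case: IHa => [|-> ->]; rewrite ?eR1 ?est ?em.
Qed.

(** The mask is read as instructions for going backwards: a true bit extracts, a false bit deletes
    the last entry of the row. The size bound leaves enough entries after each deletion for
    [extractable_rcons] to preserve extractability. *)
Lemma run_surj R st m : sorted <%O R -> uniq (R ++ st) -> extractable R st ->
    count id m = size st -> (size m + count negb m <= size R)%N ->
  exists R0 a, [/\ sorted <%O R0, perm_eq (R0 ++ a) (R ++ st)
                 & run R0 a = (R, st, m)].
Proof.
elim: m R st => [|b m IH] R st sR uR ex /=.
  by case: st uR ex => // *; exists R, [::].
case: b => /=.
  case: st uR ex => //= y st uR; rewrite add1n add0n.
  move: uR; rewrite uniq_cat_cons /= => /andP[].
  rewrite mem_cat negb_or => /andP[yR yst] uR.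
  case E: row_extract => [[R1 x]|] // ex [szst] szR.
  have [ins sR1 p1] := row_extract_insert sR yR E.
  have pp : perm_eq (x :: R1 ++ st) (y :: R ++ st).
    by rewrite -!cat_cons perm_cat2r.
  have u1 : uniq (x :: R1 ++ st).
    by rewrite (perm_uniq pp) /= mem_cat negb_or yR yst.
  have /perm_size[sz1] := p1.
  case: (IH R1 st) => // [|| R0 [a [sR0 pa Ea]]]; first by case/andP: u1.
    by rewrite sz1; lia.
  exists R0, (x :: a); split=> //; last by rewrite /= Ea ins.
  apply/seq.permP=> p; have /seq.permP/(_ p) := pp.
  by have /seq.permP/(_ p) := pa; rewrite /= !count_cat /= => ? ?; lia.
rewrite add0n => szst szR.
case/lastP: R => [|R x] in sR uR ex szR *; first by move: szR; rewrite /=; lia.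
rewrite size_rcons in szR.
have:= sR; rewrite lt_sorted_rcons => /andP[Rx sR1].
have:= uR; rewrite cat_rcons uniq_cat_cons => /andP[_ uR1].
have le_st : (size st <= size R)%N.
  by rewrite -szst; have := count_size id m; lia.
rewrite extractable_rcons // in ex.
case: (IH R st) => // [|R0 [a [sR0 pa Ea]]]; first by lia.
exists R0, (x :: a); split=> //; last by rewrite /= Ea row_insert_append.
apply/seq.permP=> p; have /seq.permP/(_ p) := pa.
by rewrite !count_cat /= => ?; lia.
Qed.

(** * Schensted's theorem: row length and longest increasing subsequences *)

Definition down_closed P := forall x y, x <= y -> P y -> P x.

(** Only [P := predT] is wanted in the end, but the induction on the word needs the bound for
    subsequences with letters below a new letter [x], hence an arbitrary down-closed [P]. *)
Definition longest word P k :=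
  (exists t, [/\ subseq t word, sorted <%O t, all P t & size t = k]) /\
  (forall t, subseq t word -> sorted <%O t -> all P t -> (size t <= k)%N).

Lemma subseq_rconsE t word x : subseq t (rcons word x) ->
  subseq t word \/ exists2 t', t = rcons t' x & subseq t' word.
Proof.
rewrite -subseq_rev rev_rcons; case/lastP: t => [|t z] /=.
  by left; apply: sub0seq.
rewrite rev_rcons /=; case: eqP => [-> | _]; rewrite -?rev_rcons subseq_rev.
  by right; exists t.
by left.
Qed.

(** A new increasing subsequence is one with letters below [x], followed by [x]. It stays within the
    down-closed [P] exactly when [P x] holds. *)
Lemma longest_rcons word x P k k' : down_closed P ->
    longest word P k -> longest word (< x) k' ->
  longest (rcons word x) P (if P x then maxn k k'.+1 else k).
Proof.
move=> dP [[t [tw st tP szt]] maxP] [[t' [tw' st' tx' szt']] maxx].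
have sub_rcons s : subseq s word -> subseq s (rcons word x).
  by move=> /subseq_trans; apply; apply: subseq_rcons.
split=> [|u /subseq_rconsE[uw|[u' -> uw]] su uP]; last first.
- rewrite -cats1 all_cat all_seq1 in uP; case/andP: uP => _ ->.
  rewrite lt_sorted_rcons in su; case/andP: su => ux su.
  by rewrite size_rcons leq_max ltnS maxx ?orbT.
- by case: ifP => _; rewrite ?leq_max maxP.
case: ifP => Px; last by exists t; split=> //; apply: sub_rcons.
case: (leqP k'.+1 k) => _; first by exists t; split=> //; apply: sub_rcons.
exists (rcons t' x); split; rewrite ?size_rcons ?szt' //.
- by rewrite -!cats1 cat_subseq.
- by rewrite lt_sorted_rcons tx' st'.
rewrite all_rcons Px; apply/allP=> z /(allP tx') /ltW zx.
exact: dP Px.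
Qed.

(** This is the recursion of [longest_rcons] for row entries. When [x] bumps [y], the count grows
    only if [P] holds at [x] and fails at [y]; the entries in [P] were then exactly those below
    [x]. *)
Lemma row_insert_count R x P : sorted <%O R -> x \notin R -> down_closed P ->
  count P (row_insert R x).1 =
    if P x then maxn (count P R) (count (< x) R).+1 else count P R.
Proof.
move=> sR xR dP.
have count_all Q s : all Q s -> count Q s = size s.
  by rewrite all_count => /eqP.
have allP_lt s : P x -> all (< x) s -> count P s = size s.
  move=> Px sx; apply/count_all/allP=> z /(allP sx)/ltW zx.
  exact: dP Px.
have count_gt z s : all (> z) s -> ~~ P z -> count P s = 0%N.
  move=> sz nPz; apply/eqP; rewrite -leqn0 leqNgt -has_count; apply/hasPn=> u.
  by move/(allP sz)/ltW=> zu; apply: contra nPz; apply: dP.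
case: (row_stepP sR xR) => [Rx _|R1 y R2 R1x xy R2y -> _ _] /=.
  rewrite -cats1 count_cat /=; case Px: (P x); last by rewrite !addn0.
  by rewrite allP_lt // count_all // (maxn_idPr (leqnSn _)) addn0 addn1.
rewrite !count_cat /=.
have c1 := count_all _ _ _ R1x.
have c2 : count (< x) R2 = 0%N.
  apply/eqP; rewrite -leqn0 leqNgt -has_count; apply/hasPn=> u /(allP R2y) yu.
  by rewrite -leNgt ltW // (lt_trans xy).
rewrite c1 c2 (lt_gtF xy); case Px: (P x).
  rewrite (allP_lt R1) //; case Py: (P y); first by lia.
  by rewrite (count_gt y R2) ?Py //; lia.
case Py: (P y) => //; by rewrite (dP x y) ?ltW in Px.
Qed.

(** Both sides obey the same recursion when a letter is added. They agree at the start because [R0]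
    is increasing, so its entries in [P] form the longest subsequence. *)
Lemma run_longest R0 a : sorted <%O R0 -> uniq (R0 ++ a) ->
  forall R st m P, run R0 a = (R, st, m) -> down_closed P ->
  longest (R0 ++ rev a) P (count P R).
Proof.
move=> sR0; elim: a => [|x a IH] /=.
  move=> _ R st m P [<- _ _] dP; rewrite cats0; split.
    exists (filter P R0); split; rewrite ?filter_subseq ?filter_all //.
      by rewrite (sorted_filter lt_trans).
    by rewrite size_filter.
  move=> t tR0 _ tP; rewrite (leq_trans _ (leq_count_subseq P tR0)) //.
  by rewrite all_count in tP; rewrite (eqP tP).
rewrite uniq_cat_cons /= => /andP[xRa uRa] R st m P.
move: (IH uRa) (runP sR0 uRa).
case: run => [[R1 st1] m1] /(_ _ _ _ _ erefl) long1.
move=> /(_ _ _ _ erefl)[sR1 pR1 _ _ _].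
have xR1 : x \notin R1.
  by apply: contra xRa => xR; rewrite -(perm_mem pR1) mem_cat xR.
move=> E dP; have -> : R = (row_insert R1 x).1.
  by case: (row_stepP sR1 xR1) E => [_ _|R2 y R3 _ _ _ _ _ _] [<-].
rewrite row_insert_count // rev_cons -rcons_cat.
apply: longest_rcons => //; apply: long1 => // u v uv; exact: le_lt_trans.
Qed.

Lemma run_lis R0 a : sorted <%O R0 -> uniq (R0 ++ a) ->
  forall R st m, run R0 a = (R, st, m) ->
  longest (R0 ++ rev a) predT (size R).
Proof.
move=> sR0 uR R st m E; rewrite -(count_predT R).
exact: run_longest E _.
Qed.

End RowInsertion.

(** * Bit masks of given length, grouped by their number of true bits *)

Fixpoint masks k : seq bitseq :=
  if k is k'.+1 then map (cons true) (masks k') ++ map (cons false) (masks k')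
  else [:: [::]].

Lemma mem_masks k m : (m \in masks k) = (size m == k).
Proof.
elim: k m => [|k IH] [|b m] //=.
  by rewrite mem_cat; apply/norP; split; apply/mapP=> -[].
rewrite mem_cat eqSS -IH; apply/orP/idP => [[]/mapP[m' m'k [_ ->]]//|mk].
by case: b; [left|right]; apply: map_f.
Qed.

Lemma masks_uniq k : uniq (masks k).
Proof.
elim: k => // k IH /=; rewrite cat_uniq !map_inj_uniq ?IH => [|? ? []|? ? []] //.
by rewrite andbT; apply/hasPn=> _ /mapP[m _ ->]; apply/mapP=> -[].
Qed.

Lemma count_masks k s : count (fun m => count id m == s) (masks k) = 'C(k, s).
Proof.
elim: k s => [|k IH] [|s]; rewrite /= ?count_cat ?count_map /preim /=.
- by [].
- by rewrite bin0n.
- rewrite (eq_count (a2 := pred0)) // count_pred0 (eq_count (a2 := fun m => count id m == 0)) //.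
  by rewrite IH !bin0.
by rewrite binS addnC -!IH; congr (_ + _); apply: eq_count.
Qed.

Lemma sum_masks k (F : nat -> nat) :
  \sum_(m <- masks k) F (count id m) = \sum_(0 <= s < k.+1) 'C(k, s) * F s.
Proof.
rewrite big_mkord (eq_big_seq (fun m => \sum_(s < k.+1 | count id m == s) F s)).
  rewrite (exchange_big_dep predT) //=; apply: eq_bigr => s _.
  by rewrite big_const_seq iter_addn_0 count_masks mulnC.
move=> m; rewrite mem_masks => /eqP szm.
have lt_m : count id m < k.+1 by rewrite ltnS -szm count_size.
by rewrite (big_pred1 (Ordinal lt_m)) // => s; rewrite /= eq_sym.
Qed.

(** * Counting words of distinct letters by their bumping mask *)

Section Words.
Variables (d : Order.disp_t) (T : finOrderType d).
Implicit Types (a st R : seq T) (m : bitseq).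

Definition words k : seq (seq T) :=
  [seq tval t | t <- enum [set t : k.-tuple T | uniq t]].

Lemma mem_words k a : (a \in words k) = (size a == k) && uniq a.
Proof.
apply/mapP/andP => [[t + ->]|[sza ua]].
  by rewrite mem_enum inE size_tuple eqxx.
by exists (Tuple sza); rewrite // mem_enum inE.
Qed.

Lemma words_uniq k : uniq (words k).
Proof. by rewrite map_inj_uniq ?enum_uniq //; apply: val_inj. Qed.

Lemma size_words k : size (words k) = #|T| ^_ k.
Proof.
rewrite size_map -cardE -(card_uniq_tuples k (@predT T)).
by apply: eq_card => t; rewrite !inE all_predT.
Qed.

(** Over the full alphabet a sorted row is determined by the letters outside it. This gives the
    initial row from the inserted word, and the final row from the bumped letters. *)
Definition compl_row a : seq T := [seq x <- sort <=%O (enum T) | x \notin a].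

Lemma compl_row_sorted a : sorted <%O (compl_row a).
Proof.
by rewrite (sorted_filter lt_trans) // sort_lt_sorted enum_uniq.
Qed.

Lemma mem_compl_row a x : (x \in compl_row a) = (x \notin a).
Proof. by rewrite mem_filter mem_sort mem_enum andbT. Qed.

Lemma compl_row_uniq a : uniq a -> uniq (compl_row a ++ a).
Proof.
move=> ua; rewrite cat_uniq ua andbT (lt_sorted_uniq (compl_row_sorted a)) /=.
by apply/hasPn=> x; rewrite mem_compl_row negbK.
Qed.

Lemma perm_compl_row a : uniq a -> perm_eq (compl_row a ++ a) (enum T).
Proof.
move=> ua; apply: uniq_perm; rewrite ?enum_uniq ?compl_row_uniq //.
by move=> x; rewrite mem_cat mem_compl_row mem_enum orNb.
Qed.

Lemma size_compl_row a : uniq a -> size (compl_row a) + size a = #|T|.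
Proof. by move=> ua; rewrite -size_cat (perm_size (perm_compl_row ua)) cardE. Qed.

Lemma compl_rowE R a :
  sorted <%O R -> perm_eq (R ++ a) (enum T) -> R = compl_row a.
Proof.
move=> sR pR; apply: lt_sorted_eq (compl_row_sorted a) _ => // x.
have:= perm_uniq pR; rewrite enum_uniq cat_uniq => /and3P[_ /hasPn dis _].
have:= perm_mem pR x; rewrite mem_compl_row mem_cat mem_enum.
by case: (boolP (x \in a)) => [/dis/negPf-> //|_]; rewrite orbF.
Qed.

Definition run_mask a : bitseq := (run (compl_row a) a).2.

(** For a fixed mask, sending a word to its bumped letters is a bijection onto the extractable
    words: the final row is the complement of the bumped letters, so [run_inj] and [run_surj] apply.
    The right side sees [m] only through its number of true bits. *)
Lemma count_words_mask k m : size m = k -> 2 * k <= #|T| ->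
  count (fun a => run_mask a == m) (words k) =
  count (fun st => extractable (compl_row st) st) (words (count id m)).
Proof.
move=> szm le_k; rewrite -[LHS]size_filter -[RHS]size_filter.
rewrite -(size_map (fun a => (run (compl_row a) a).1.2)).
apply/perm_size/uniq_perm; rewrite ?filter_uniq ?words_uniq //.
  rewrite map_inj_in_uniq ?filter_uniq ?words_uniq // => a b.
  rewrite !mem_filter !mem_words => /and3P[/eqP ma _ ua] /and3P[/eqP mb _ ub] eab.
  have sub (c : seq T) (uc : uniq c) := runP (compl_row_sorted c) (compl_row_uniq uc).
  apply: (run_inj (compl_row_sorted a) (compl_row_uniq ua)
            (compl_row_sorted b) (compl_row_uniq ub) _).2.
  move: ma mb eab (sub a ua) (sub b ub); rewrite /run_mask.
  case: run => [[R st] m1]; case: run => [[R' st'] m1'] /= -> -> ->.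
  move=> /(_ _ _ _ erefl)[sR pR _ _ _] /(_ _ _ _ erefl)[sR' pR' _ _ _].
  rewrite (compl_rowE sR (perm_trans pR (perm_compl_row ua))).
  by rewrite (compl_rowE sR' (perm_trans pR' (perm_compl_row ub))).
move=> st; rewrite mem_filter mem_words; apply/mapP/and3P.
  move=> [a]; rewrite mem_filter mem_words => /and3P[/eqP + /eqP sza ua] ->.
  (* The hypothesis now says that the initial row has at least [k] letters, as [run_extractable]
     requires. *)
  rewrite -(size_compl_row ua) sza in le_k.
  move: (runP (compl_row_sorted a) (compl_row_uniq ua)).
  move: (run_extractable (compl_row_sorted a) (compl_row_uniq ua)).
  rewrite /run_mask; case: run => [[R st1] m1] /= ext.
  move=> /(_ _ _ _ erefl)[sR pR _ cm _] em.
  have pR' := perm_trans pR (perm_compl_row ua).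
  rewrite -(compl_rowE sR pR') -em cm eqxx; split=> //.
    by apply: (ext _ R st1 m1 erefl); lia.
  by have := perm_uniq pR; rewrite compl_row_uniq // cat_uniq => /and3P[].
move=> [ext /eqP szst ust]; rewrite -(size_compl_row ust) in le_k.
case: (run_surj (compl_row_sorted st) (compl_row_uniq ust) ext (esym szst)).
  have : count id m + count negb m = size m by exact: count_predC.
  (* With [size st] added, the left side is the length of [m] plus its true and false bits, which is
     [2 * k]; the right side is [#|T|]. *)
  rewrite -(leq_add2r (size st)) => szE; apply: leq_trans le_k.
  by rewrite szst; lia.
move=> R0 [a [sR0 pR0 E]].
have pR0' := perm_trans pR0 (perm_compl_row ust).
have eR0 := compl_rowE sR0 pR0'.
have uRa : uniq (R0 ++ a) by rewrite (perm_uniq pR0') enum_uniq.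
exists a; last by rewrite -eR0 E.
rewrite mem_filter mem_words /run_mask -eR0 E eqxx /=.
case: (runP sR0 uRa E) => _ _ <- _ _; rewrite szm eqxx /=.
by move: uRa; rewrite cat_uniq => /and3P[].
Qed.

(** By [count_words_mask] the all-true mask of length [s] can be traded for any mask of length [k]
    with [s] true bits. There are ['C(k, s)] of these, and each word of length [k] has exactly one
    mask. *)
Lemma sum_count_words k : 2 * k <= #|T| ->
  \sum_(0 <= s < k.+1)
     'C(k, s) * count (fun a => run_mask a == nseq s true) (words s) =
  #|T| ^_ k.
Proof.
move=> le_k; rewrite -size_words.
pose v s := count (fun st => extractable (compl_row st) st) (words s).
rewrite (eq_big_nat _ _ (F2 := fun s => 'C(k, s) * v s)); last first.
  move=> s /andP[_ lt_s]; congr (_ * _).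
  rewrite (count_words_mask (m := nseq s true)) ?size_nseq //; last by lia.
  by rewrite count_nseq mul1n.
rewrite -sum_masks (eq_big_seq (fun m =>
  \sum_(a <- words k | run_mask a == m) 1)); last first.
  move=> m; rewrite mem_masks => /eqP szm.
  by rewrite sum1_count (count_words_mask szm).
rewrite (exchange_big_dep predT) //= -sum1_size; apply: eq_big_seq => a.
rewrite mem_words => /andP[/eqP sza ua].
rewrite sum1_count (eq_count (a2 := pred1 (run_mask a))); last first.
  by move=> m; rewrite /= eq_sym.
rewrite count_uniq_mem ?masks_uniq // mem_masks /run_mask.
move: (runP (compl_row_sorted a) (compl_row_uniq ua)).
by case: run => [[R st] m] /(_ _ _ _ erefl)[_ _ -> _ _]; rewrite sza eqxx.
Qed.

End Words.

(** * From permutations to words: the tail determines the permutation *)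

Section Permutations.
Variable n : nat.
Implicit Types (w : 'S_n) (A : {set 'I_n}) (a u : seq 'I_n).

Lemma enum_ord_lt_sorted : sorted <%O (enum 'I_n).
Proof.
have := iota_ltn_sorted 0 n; rewrite -val_enum_ord sorted_map.
by apply: sub_sorted => i j; rewrite ltEord.
Qed.

Lemma enum_set_lt_sorted A : sorted <%O (enum A).
Proof.
have -> : enum A = filter (mem A) (enum 'I_n) by rewrite [in RHS]enumT.
exact: (sorted_filter lt_trans) enum_ord_lt_sorted.
Qed.

Lemma increasing_onE w A :
  increasing_on w A = sorted <%O (map w (enum A)).
Proof.
have sA := enum_set_lt_sorted A.
rewrite (sorted_pairwise lt_trans) pairwise_map; apply/idP/idP.
  move=> /forall_inP incA; move: sA; rewrite (sorted_pairwise lt_trans).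
  apply: (sub_in_pairwise (P := mem A)); last by apply/allP=> i; rewrite mem_enum.
  by move=> i j iA jA ij; have /forall_inP/(_ j jA)/implyP := incA i iA; apply.
move=> pA; apply/forall_inP=> i iA; apply/forall_inP=> j jA; apply/implyP=> ij.
rewrite -mem_enum in iA; rewrite -mem_enum in jA.
have swA : sorted <%O (map w (enum A)).
  by rewrite (sorted_pairwise lt_trans) pairwise_map.
have inj_w := @perm_inj _ w.
have lt_ij := sorted_ltn_index lt_trans swA _ _ (map_f w iA) (map_f w jA).
rewrite !index_map // in lt_ij; apply: lt_ij; rewrite ltnNge; apply/negP=> le_ji.
have := sorted_leq_index le_trans lexx (sub_sorted (@ltW _ _) sA) _ _ jA iA le_ji.
by rewrite leEord leqNgt ij.
Qed.

Lemma enum_initial p : enum [set i : 'I_n | i < p] = take p (enum 'I_n).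
Proof.
apply: lt_sorted_eq; first exact: enum_set_lt_sorted.
  exact: take_sorted enum_ord_lt_sorted.
move=> i; rewrite mem_enum inE -(mem_map val_inj) map_take val_enum_ord.
by rewrite take_iota mem_iota /=; have := ltn_ord i; lia.
Qed.

Lemma increasing_initial w p :
  increasing_on w [set i : 'I_n | i < p] = sorted <%O (take p (codom w)).
Proof. by rewrite increasing_onE enum_initial map_take codomE. Qed.

Lemma lis_longest w k : longest (codom w) predT k -> lis w = k.
Proof.
case=> [[t [tw st _ <-]] max_t]; apply/eqP; rewrite eqn_leq; apply/andP; split.
  apply/bigmax_leqP=> A; rewrite increasing_onE => sA.
  rewrite cardE -(size_map w) max_t //; last exact/allP.
  rewrite codomE map_subseq // [X in subseq _ X]enumT; exact: filter_subseq.
move: tw; rewrite codomE => /subseqP[m szm tE].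
pose u := mask m (enum 'I_n).
have tu : t = map w u by rewrite tE map_mask.
have su : sorted <%O u.
  exact: (subseq_sorted lt_trans (mask_subseq _ _)) enum_ord_lt_sorted.
(* The positions are listed increasingly, so passing to a set and back loses nothing. *)
have uE : enum [set i in u] = u.
  by apply: lt_sorted_eq (enum_set_lt_sorted _) su _ => i; rewrite mem_enum inE.
apply: (bigop.bigmax_sup [set i in u]); first by rewrite increasing_onE uE -tu.
by rewrite cardE uE tu size_map.
Qed.

(* Reversed, as [run] expects the last letter first. *)
Definition tail s w : seq 'I_n := rev (drop (n - s) (codom w)).

Lemma size_codom_perm w : size (codom w) = n.
Proof. by rewrite size_codom card_ord. Qed.

Lemma codom_perm_uniq w : uniq (codom w).
Proof. by apply/injectiveP; apply: perm_inj. Qed.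

Lemma tail_uniq s w : uniq (tail s w).
Proof. by rewrite rev_uniq drop_uniq ?codom_perm_uniq. Qed.

Lemma size_tail s w : s <= n -> size (tail s w) = s.
Proof. by rewrite size_rev size_drop size_codom_perm => /subKn. Qed.

Lemma take_codom s w : sorted <%O (take (n - s) (codom w)) ->
  take (n - s) (codom w) = compl_row (tail s w).
Proof.
move=> sw; apply: compl_rowE => //.
apply: (perm_trans (y := codom w)).
  by rewrite -[X in perm_eq _ X](cat_take_drop (n - s)) perm_cat2l perm_rev.
apply: uniq_perm; rewrite ?codom_perm_uniq ?enum_uniq // => i.
by rewrite mem_enum -[i](permKV w) codom_f.
Qed.

Lemma codom_compl_row s w : sorted <%O (take (n - s) (codom w)) ->
  codom w = compl_row (tail s w) ++ rev (tail s w).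
Proof. by move=> /take_codom <-; rewrite revK cat_take_drop. Qed.

Lemma codom_surj u : uniq u -> size u = n -> exists w, codom w = u.
Proof.
move=> uu /eqP szu; pose t := Tuple szu.
have inj_t : injective (tnth t) by apply/tuple_uniqP.
exists (perm inj_t); rewrite codomE.
by rewrite (eq_map (permE inj_t)) map_tnth_enum.
Qed.

(** By [run_lis], [lis w] is the final row length, namely [n - s] plus the number of appends.
    Equality therefore means that every bit of the mask is true. *)
Lemma lis_run_mask s w : s <= n -> sorted <%O (take (n - s) (codom w)) ->
  (lis w == n - s) = (run_mask (tail s w) == nseq s true).
Proof.
move=> le_s sw; have ut := tail_uniq s w.
have eq_w := codom_compl_row sw.
have szc : size (compl_row (tail s w)) = n - s.
  by rewrite -take_codom // size_take_min size_codom_perm; lia.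
have szt := size_tail w le_s.
move: (runP (compl_row_sorted _) (compl_row_uniq ut)).
move: (run_lis (compl_row_sorted _) (compl_row_uniq ut)).
rewrite -eq_w /run_mask; case: run => [[R st] m] /(_ _ _ _ erefl) longR.
move=> /(_ _ _ _ erefl)[_ _ szm _ szR].
rewrite (lis_longest longR) szR szc -[X in _ == X]addn0 eqn_add2l /=.
rewrite -szt -szm -leqn0 leqNgt -has_count -all_predC.
apply/allP/eqP => [mT|-> b /nseqP[-> _] //].
by apply/all_pred1P/allP=> b /mT /=; case: b.
Qed.

(** The map [tail s] is a bijection: the increasing initial part of the permutation must be the
    complement of the tail, listed in order. *)
Lemma card_Pi s : s <= n ->
  #|Pi n s| = count (fun a => run_mask a == nseq s true) (words 'I_n s).
Proof.
move=> le_s; rewrite cardE -(size_map (tail s)) -size_filter.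
have in_Pi w : (w \in Pi n s) = sorted <%O (take (n - s) (codom w)) &&
    (run_mask (tail s w) == nseq s true).
  rewrite inE increasing_initial; case: (boolP (sorted _ _)) => //= sw.
  exact: lis_run_mask.
apply/perm_size/uniq_perm; rewrite ?filter_uniq ?words_uniq //.
  rewrite map_inj_in_uniq ?enum_uniq // => w w'.
  rewrite !mem_enum !in_Pi => /andP[sw _] /andP[sw' _] eq_t.
  have : codom w = codom w' by rewrite (codom_compl_row sw) (codom_compl_row sw') eq_t.
  rewrite !codomE => /eq_in_map eq_w; apply/permP=> i.
  by rewrite eq_w ?mem_enum.
move=> a; rewrite mem_filter mem_words; apply/mapP/and3P.
  move=> [w]; rewrite mem_enum in_Pi => /andP[sw rw] ->.
  by rewrite rw size_tail // eqxx tail_uniq.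
move=> [ra /eqP sza ua].
have szc : size (compl_row a) = n - s.
  by have := size_compl_row ua; rewrite card_ord sza; lia.
have [||w wE] := @codom_surj (compl_row a ++ rev a).
- have ua' := compl_row_uniq ua.
  by rewrite (perm_uniq (_ : perm_eq _ (compl_row a ++ a))) // perm_cat2l perm_rev.
- by rewrite size_cat size_rev szc sza subnK.
have tw : tail s w = a by rewrite /tail wE drop_size_cat ?revK.
exists w => //; rewrite mem_enum in_Pi tw ra andbT wE take_size_cat //.
exact: compl_row_sorted.
Qed.

End Permutations.

Theorem proposition1 (n k : nat) (hnk : 2 * k <= n) :
  \sum_(0 <= s < k.+1) 'C(k, s) * #|Pi n s| = 'C(n, k) * k`!.
Proof.
(* The right side is the falling factorial, the number of words of [k] distinct letters. *)
rewrite bin_ffact -[n in n ^_ k]card_ord -(@sum_count_words _ 'I_n) ?card_ord //.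
apply: eq_big_nat => s /andP[_ lt_s]; rewrite card_Pi //; lia.
Qed.
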